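(* For each fixed $d \geq 2$ and $n \geq 1$, $$\{\, p_{n}(F) : F \text{ is a continuous distribution function on } \mathbb{R}^d \,\} = [n^{-1}, 1].$$ That is, the image of the mapping $F \mapsto p_n(F)$ on the domain of all continuous distributions on $\mathbb{R}^d$ is precisely the interval $[n^{-1}, 1]$, irrespective of $d$.
   Context: For $\mathbf{x}, \mathbf{y} \in \mathbb{R}^d$, write $\mathbf{x} \leq \mathbf{y}$ if $x_j \leq y_j$ for all $1 \leq j \leq d$. Let $F$ be a continuous distribution function on $\mathbb{R}^d$ and let $\mathbf{X}^{(1)}, \mathbf{X}^{(2)}, \dots$ be i.i.d. random vectors with distribution function $F$. For $n \geq 1$, $\mathbf{X}^{(n)}$ sets a (Pareto) record if $\mathbf{X}^{(n)} \leq \mathbf{X}^{(i)}$ fails for all $1 \leq i < n$. Let $p_n(F) \equiv p_{n,d}(F)$ denote the probability that $\mathbf{X}^{(n)}$ sets a record. *)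

(* Defs.v *)
From HB Require Import structures.
From mathcomp Require Import all_boot all_order all_algebra finmap.
From mathcomp Require Import all_classical all_reals all_analysis.

Set Implicit Arguments.
Unset Strict Implicit.
Unset Printing Implicit Defensive.
Import Order.TTheory GRing.Theory Num.Theory.
Import numFieldNormedType.Exports.
Local Open Scope classical_set_scope.
Local Open Scope ring_scope.

(* A point of R^d is a d.-tuple of reals.  The canonical sigma-algebra on
   d.-tuple R is generated by the coordinate maps and the Borel sets of R; it is
   the Borel sigma-algebra of R^d. *)

Definition levec (R : realType) (d : nat) (x y : d.-tuple R) : Prop :=
  forall j : 'I_d, tnth x j <= tnth y j.

Definition law_has_df (R : realType) (d : nat)
    (mu : probability (d.-tuple R) R) (F : d.-tuple R -> R) : Prop :=
  forall x : d.-tuple R, mu [set y | levec y x] = (F x)%:E.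

(* Tuples carry no topology in the library, so continuity is expressed through
   the identification of row vectors, which have the usual topology of R^d,
   with tuples. *)
Definition continuous_df (R : realType) (d : nat) (F : d.-tuple R -> R) : Prop :=
  (exists mu : probability (d.-tuple R) R, law_has_df mu F) /\
  continuous (fun v : 'rV[R]_d => F [tuple v ord0 j | j < d]).

Definition mutually_independent (R : realType) (disp disp' : measure_display)
    (T : measurableType disp) (T' : measurableType disp') (P : probability T R)
    (I : set nat) (X : nat -> {RV P >-> T'}) : Prop :=
  forall (J : {fset nat}) (B : nat -> set T'),
    [set` J] `<=` I -> (forall i, measurable (B i)) ->
    P (\bigcap_(i in [set` J]) (X i @^-1` B i)) =
    (\prod_(i <- J) P (X i @^-1` B i))%E.

Definition iid_with_df (R : realType) (d : nat) (F : d.-tuple R -> R)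
    (disp : measure_display) (T : measurableType disp) (P : probability T R)
    (I : set nat) (X : nat -> {RV P >-> d.-tuple R}) : Prop :=
  (forall i, I i -> law_has_df (distribution P (X i)) F) /\
  mutually_independent I X.

Definition sets_record (R : realType) (d : nat) (T : Type)
    (X : nat -> T -> d.-tuple R) (n : nat) : set T :=
  [set t | forall i : nat, (1 <= i < n)%N -> ~ levec (X n t) (X i t)].

(* "The" probability that X^(n) sets a record, for X^(1), ..., X^(n) i.i.d. with
   distribution function F, on any probability space: the set below is a
   singleton whenever F is a distribution function and n >= 1.  Only the first n
   vectors are constrained, the event does not involve the others. *)
Definition record_prob (R : realType) (d n : nat) (F : d.-tuple R -> R) : R :=
  xget 0 [set p : R | exists (disp : measure_display) (T : measurableType disp)
      (P : probability T R) (X : nat -> {RV P >-> d.-tuple R}),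
    iid_with_df F [set i | (1 <= i <= n)%N] X /\
    P (sets_record X n) = p%:E].

(* Main.v *)
From HB Require Import structures.
Require Import Defs.
From mathcomp Require Import all_boot all_order all_algebra finmap.
From mathcomp Require Import all_classical all_reals all_analysis.
From mathcomp Require Import measurable_realfun ring lra.
Set Implicit Arguments.
Unset Strict Implicit.
Unset Printing Implicit Defensive.
Import Order.TTheory GRing.Theory Num.Theory.
Import numFieldNormedType.Exports.
Local Open Scope classical_set_scope.
Local Open Scope ring_scope.

(** Let mu be the law on R^d with distribution function F, and let
    phi x = mu {y | ~ x <= y}. Given that the last vector is x, it sets a record
    exactly when each of the n - 1 other vectors, which are independent with law
    mu, fails to dominate x. Hence p_n(F) is the integral of phi ^ (n - 1)
    against mu ([record_probE]). As a distribution function determines its law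
    ([law_of_df_unique]) and i.i.d. samples exist ([iid_sample_exists]), this
    describes the probability on every probability space.

    Lower bound. A continuous F gives mass 0 to every hyperplane {y_j = a}
    ([hyperplane_null]), so phi x >= mu {y | y_j < x_j} = mu {y | y_j <= x_j}.
    The integral of mu {y | y_j <= x_j} ^ (n - 1) is the probability that a given
    vector of an n-sample has the largest j-th coordinate. By symmetry it is
    the same for each of the n vectors, and the n events cover the
    whole space, so it is at least 1/n ([integral_expe_ge_invn]).

    Every value is attained. Let u be uniform on [0, 1], and place a point at
    (u, ..., u), except that one coordinate is replaced by 3 - u when u < t.
    The points with u < t form an antichain and are dominated by no other point,
    so they have phi = 1; a point with u >= t is dominated exactly by the points
    with parameter at least u, so it has phi = u. Thus
    p_n = t + (integral of u ^ (n - 1) over [t, 1]) = t + (1 - t ^ n) / n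
    ([record_prob_folded]), which moves continuously from 1/n at t = 0 to 1 at
    t = 1. *)

(** * Measurability and restricted measures *)

Lemma measurable_ler_fun (R : realType) disp (T : measurableType disp)
    (f g : T -> R) :
  measurable_fun setT f -> measurable_fun setT g ->
  measurable [set t | f t <= g t].
Proof.
move=> mf mg; have := measurable_fun_ler mf mg measurableT (Y := [set true]).
by rewrite setTI; apply.
Qed.

Lemma measurable_fun_expe d (T : measurableType d) (R : realType)
    (f : T -> \bar R) k : measurable_fun setT f ->
  measurable_fun setT (fun x => f x ^+ k)%E.
Proof.
move=> mf; elim: k => [|k ih]; first exact: measurable_cst.
by under eq_fun do rewrite expeS; exact: emeasurable_funM.
Qed.

Lemma lee_expe (R : realDomainType) (x y : \bar R) k :
  (0 <= x)%E -> (x <= y)%E -> (x ^+ k <= y ^+ k)%E.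
Proof.
move=> x0 xy; elim: k => // k ih; rewrite !expeS; apply: lee_pmul => //.
exact: expe_ge0.
Qed.

Section restriction.
Local Open Scope ereal_scope.
Context d (T : measurableType d) (R : realType).
Variable mu : {measure set T -> \bar R}.

Lemma ge0_integral_mrestr (D : set T) (mD : measurable D) (f : T -> \bar R) :
  measurable_fun setT f -> (forall x, 0 <= f x) ->
  \int[mrestr mu mD]_x f x = \int[mu]_(x in D) f x.
Proof.
move=> mf f0.
rewrite -(setUv D) ge0_integral_setU//=; last 3 first.
- exact: measurableC.
- by rewrite setUv.
- apply/disj_setPS; by rewrite setICr.
rewrite [X in _ + X]null_set_integral ?adde0//; last 3 first.
- exact: measurableC.
- exact: measurable_funTS.
- by rewrite /= /mrestr setICl measure0.
apply: eq_measure_integral => A mA AD /=.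
by rewrite /mrestr setIidl.
Qed.

End restriction.

Section image_measure.
Local Open Scope ereal_scope.
Context d d' (T : measurableType d) (T' : measurableType d') (R : realType).

(** Finite measures are allowed, because this is applied to a probability
    restricted to an event, whose total mass is in general less than 1. *)
Definition image_measure (Q : set T -> \bar R) (X : {mfun T >-> T'}) :=
  pushforward Q X.

Variables (Q : {finite_measure set T -> \bar R}) (X : {mfun T >-> T'}).

Let image0 : image_measure Q X set0 = 0.
Proof. exact: measure0. Qed.

Let image_ge0 A : 0 <= image_measure Q X A.
Proof. exact: measure_ge0. Qed.

Let image_sigma_additive : semi_sigma_additive (image_measure Q X).
Proof. exact: measure_semi_sigma_additive. Qed.

HB.instance Definition _ := isMeasure.Build _ _ _ (image_measure Q X)
  image0 image_ge0 image_sigma_additive.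

Let image_finite : fin_num_fun (image_measure Q X).
Proof.
by move=> A mA; apply: fin_num_measure; exact: measurable_funPTI.
Qed.

HB.instance Definition _ :=
  @Measure_isFinite.Build _ T' _ (image_measure Q X) image_finite.

Lemma ge0_integral_image_measure (f : T' -> \bar R) :
  measurable_fun setT f -> (forall x, 0 <= f x) ->
  \int[image_measure Q X]_x f x = \int[Q]_t f (X t).
Proof. by move=> mf f0; rewrite ge0_integral_pushforward. Qed.

End image_measure.

(** * Integrating out independent variables *)

Section independent_pair.
Local Open Scope ereal_scope.
Context d d' (T : measurableType d) (E : measurableType d') (R : realType).
Variables (P : probability T R) (mu : probability E R).
Variables (X Y : {mfun T >-> E}) (H : set T).
Hypothesis mH : measurable H.
Hypothesis indep : forall A B, measurable A -> measurable B ->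
  P (H `&` X @^-1` A `&` Y @^-1` B) = P (H `&` X @^-1` A) * mu B.
Variable S : set (E * E).
Hypothesis mS : measurable S.

(** By hypothesis [(X, Y)] has, under [P] restricted to [H], the same value on
    rectangles as the product of the law of [X] with [mu]. The two measures are
    therefore equal, and Tonelli integrates [Y] out. *)
Lemma integral_indep_pair (f : E -> \bar R) :
  measurable_fun setT f -> (forall x, 0 <= f x) ->
  \int[P]_(t in H `&` [set t | S (X t, Y t)]) f (X t) =
  \int[P]_(t in H) (f (X t) * mu (xsection S (X t))).
Proof.
move=> mf f0.
pose Z t := (X t, Y t).
have mZ : measurable_fun setT Z by apply/measurable_fun_pairP.
pose Zm : {mfun T >-> (E * E)%type} := HB.pack Z (isMeasurableFun.Build _ _ _ _ _ mZ).
pose Q : {finite_measure set T -> \bar R} := mrestr P mH.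
pose g (z : E * E) := f z.1 * (\1_S z)%:E.
have mg : measurable_fun setT g.
  apply: emeasurable_funM; first exact: measurableT_comp.
  exact/measurable_EFinP/measurable_indic.
have g0 z : 0 <= g z by rewrite mule_ge0// lee_fin.
have -> : \int[P]_(t in H `&` [set t | S (X t, Y t)]) f (X t) =
   \int[Q]_t (g \o Zm) t.
  rewrite ge0_integral_mrestr; [|exact: measurableT_comp|by move=> t; exact: g0].
  rewrite integral_mkcondr; apply: eq_integral => t _.
  rewrite /g/= patchE indicE.
  have -> : (t \in [set t | S (X t, Y t)]) = (Z t \in S).
    by apply/idP/idP; rewrite !inE.
  by case: ifP => _; rewrite ?mule1 ?mule0.
rewrite -ge0_integral_image_measure//.
have -> : \int[image_measure Q Zm]_z g z =
   \int[image_measure Q X \x mu]_z g z.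
  apply: eq_measure_integral => C mC _ /=.
  apply/esym/product_measure_unique => // A B mA mB.
  rewrite /= /image_measure /pushforward/= /mrestr (setIC (X @^-1` _)).
  rewrite -indep//; congr (P _); apply/seteqP; split => t /=; tauto.
rewrite fubini_tonelli1//.
rewrite -[RHS](ge0_integral_mrestr _ mH).
- rewrite ge0_integral_image_measure//=; last 2 first.
  + exact: measurable_fun_fubini_tonelli_F.
  + by move=> x; apply: integral_ge0 => y _; exact: g0.
  apply: eq_integral => t _ /=.
  have mSx : measurable (xsection S (X t)) by exact: measurable_xsection.
  transitivity (\int[mu]_y (f (X t) * (\1_(xsection S (X t)) y)%:E)).
    by apply: eq_integral => y _; rewrite /g /= !indicE mem_xsection.
  rewrite ge0_integralZl ?integral_indic ?setIT//.
  + exact/measurable_EFinP/measurable_indic.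
- apply: emeasurable_funM; first exact: measurableT_comp.
  apply: (measurableT_comp (measurable_fun_xsection _ mS)) => //.
- by move=> t; rewrite mule_ge0.
Qed.

End independent_pair.

Section independent_family.
Local Open Scope ereal_scope.
Context d d' (T : measurableType d) (E : measurableType d') (R : realType).
Variables (P : probability T R) (mu : probability E R).
Variables (I : set nat) (X : nat -> {RV P >-> E}).
Hypothesis indep : mutually_independent I X.
Hypothesis lawX : forall i A, I i -> measurable A -> P (X i @^-1` A) = mu A.
Variable S : set (E * E).
Hypothesis mS : measurable S.

Definition related_to (m : nat) (s : seq nat) : set T :=
  [set t | forall i, i \in s -> S (X m t, X i t)].

Lemma related_to_cons m i s : related_to m (i :: s) =
  related_to m s `&` [set t | S (X m t, X i t)].
Proof.
apply/seteqP; split => t.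
  move=> h; split; last by apply: h; rewrite mem_head.
  by move=> j js; apply: h; rewrite in_cons js orbT.
by move=> [hs hi] j; rewrite in_cons => /orP[/eqP ->//|]; exact: hs.
Qed.

Lemma measurable_related m i : measurable [set t | S (X m t, X i t)].
Proof.
have mZ : measurable_fun setT (fun t => (X m t, X i t)).
  by apply/measurable_fun_pairP.
by have := mZ measurableT _ mS; rewrite setTI.
Qed.

Lemma measurable_related_to m s : measurable (related_to m s).
Proof.
elim: s => [|i s ih].
  by rewrite (_ : related_to m [::] = setT)//; apply/seteqP; split.
by rewrite related_to_cons; apply: measurableI => //; exact: measurable_related.
Qed.

Lemma measurable_event (J : {fset nat}) (B : nat -> set E) :
  (forall i, measurable (B i)) ->
  measurable (\bigcap_(i in [set` J]) (X i @^-1` B i)).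
Proof.
by move=> mB; apply: bigcap_measurableType => i _; exact: measurable_funPTI.
Qed.

Lemma bigcap_fset_set1 (i : nat) (J : {fset nat}) (F : nat -> set T) :
  \bigcap_(k in [set` (i |` J)%fset]) F k = F i `&` \bigcap_(k in [set` J]) F k.
Proof.
apply/seteqP; split => t /=.
  move=> h; split; first by apply: h; rewrite /= in_fset1U eqxx.
  by move=> k kJ; apply: h; rewrite /= in_fset1U [k \in J]kJ orbT.
by move=> [hi hJ] k /=; rewrite in_fset1U => /orP[/eqP ->//|]; exact: hJ.
Qed.

(** Induction on [s], integrating out one variable at a time with
    [integral_indep_pair]. The function [f] is general so that it can absorb the
    factor produced by each integration. The side event on [J] is there to prove
    the hypothesis of [integral_indep_pair]: the independence of the next variable
    from what has already been imposed is the induction hypothesis with that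
    variable moved into [J]. *)
Lemma integral_independent_family m s (J : {fset nat}) (B : nat -> set E)
    (f : E -> \bar R) :
  I m -> uniq (m :: s) -> (forall i, i \in s -> I i) ->
  [set` J] `<=` I -> (forall i, i \in J -> i \notin m :: s) ->
  (forall i, measurable (B i)) ->
  measurable_fun setT f -> (forall x, 0 <= f x) ->
  \int[P]_(t in related_to m s `&` \bigcap_(i in [set` J]) (X i @^-1` B i))
     f (X m t) =
  (\int[mu]_x (f x * mu (xsection S x) ^+ size s)) * \prod_(i <- J) mu (B i).
Proof.
move=> Im; elim: s J B f => [|i s ih] J B f us sI JI Js mB mf f0.
  have -> : related_to m [::] = setT by apply/seteqP; split.
  rewrite setTI -(ge0_integral_mrestr _ (measurable_event J mB)); last 2 first.
  - exact: measurableT_comp.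
  - by [].
  pose Q : {finite_measure set T -> \bar R} := mrestr P (measurable_event J mB).
  rewrite -(ge0_integral_image_measure Q (X m))//=.
  (* Under [P] restricted to the event on [J], the law of [X m] is [c] times [mu]. *)
  pose c : R := (\prod_(i <- J) fine (mu (B i)))%R.
  have cE : \prod_(i <- J) mu (B i) = c%:E.
    rewrite /c -prodEFin; apply: eq_bigr => i _.
    by rewrite fineK// fin_num_measure.
  have c0 : (0 <= c)%R by apply: prodr_ge0 => i _; apply: fine_ge0.
  rewrite cE muleC -(ge0_integral_mscale _ _ (NngNum c0)); last 3 first.
  - by [].
  - by apply: emeasurable_funM => //; under eq_fun do rewrite expe0.
  - by move=> x _; rewrite mule1.
  under [RHS]eq_integral do rewrite mule1.
  apply: eq_measure_integral => A mA _.
  rewrite /= /mscale/= /image_measure /pushforward /= /mrestr.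
  pose B' j := if j == m then A else B j.
  have mB' j : measurable (B' j) by rewrite /B'; case: ifP.
  have mJ : m \notin J.
    by apply/negP => /Js; rewrite mem_head.
  have B'J j : j \in J -> B' j = B j.
    by rewrite /B'; case: eqP => // -> /idPn.
  have := @indep (m |` J)%fset B'.
  rewrite bigcap_fset_set1 big_fsetU1//= /B' eqxx.
  rewrite (eq_bigcapr (G := fun j => X j @^-1` B j)); last first.
    by move=> j /= jJ; rewrite -/(B' j) B'J.
  move=> ->; last 2 first.
  - move=> j /=; rewrite in_fset1U => /orP[/eqP ->//|]; exact: JI.
  - exact: mB'.
  rewrite lawX// muleC -cE; congr (_ * _).
  rewrite big_seq [RHS]big_seq; apply: eq_bigr => j jJ.
  by rewrite -/(B' j) B'J// lawX//; exact: JI.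
have [mi_s /andP[iis us']] : uniq (m :: s) /\ (i \notin s) && (m != i).
  move: us; rewrite /= in_cons negb_or => /and3P[/andP[mi ms] -> ->].
  by rewrite ms mi.
have iJ : i \notin J.
  by apply/negP => /Js; rewrite !in_cons eqxx !orbT.
have sI' j : j \in s -> I j by move=> js; apply: sI; rewrite in_cons js orbT.
have Js' j : j \in J -> j \notin m :: s.
  move=> /Js; rewrite !in_cons !negb_or => /and3P[-> _ ->] //.
have mH : measurable
  (related_to m s `&` \bigcap_(i in [set` J]) (X i @^-1` B i)).
  by apply: measurableI; [exact: measurable_related_to|exact: measurable_event].
rewrite related_to_cons setIAC.
rewrite (@integral_indep_pair _ _ _ _ _ P mu (X m) (X i) _ mH _ S mS)//.
  rewrite (ih J B (fun x => f x * mu (xsection S x)))//.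
  - congr (_ * _); apply: eq_integral => x _.
    by rewrite -muleA -expeS.
  - apply: emeasurable_funM => //; exact: measurable_fun_xsection.
  - by move=> x; rewrite mule_ge0.
have ih1 A (J' : {fset nat}) B' : measurable A -> [set` J'] `<=` I ->
    (forall j, j \in J' -> j \notin m :: s) -> (forall j, measurable (B' j)) ->
  P (related_to m s `&` \bigcap_(i in [set` J']) (X i @^-1` B' i)
     `&` X m @^-1` A) =
   (\int[mu]_x ((\1_A x)%:E * mu (xsection S x) ^+ size s)) *
      \prod_(i <- J') mu (B' i).
  move=> mA J'I J's mB'.
  rewrite -(ih J' B' (fun x => (\1_A x)%:E))//; last first.
    exact/measurable_EFinP/measurable_indic.
  rewrite setIC -integral_indic//=; last exact: measurable_funPTI.
  by apply: measurableI; [exact: measurable_related_to|exact: measurable_event].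
move=> A C mA mC.
pose B' j := if j == i then C else B j.
have mB' j : measurable (B' j) by rewrite /B'; case: ifP.
have B'J j : j \in J -> B' j = B j.
  by rewrite /B'; case: eqP => // -> /idPn.
rewrite (ih1 A J B)//.
have := ih1 A (i |` J)%fset B' mA.
rewrite bigcap_fset_set1 big_fsetU1//= /B' eqxx.
rewrite (eq_bigcapr (G := fun j => X j @^-1` B j)); last first.
  by move=> j /= jJ; rewrite -/(B' j) B'J.
rewrite [X in _ = _ * (_ * X)](_ : _ = \prod_(i <- J) mu (B i)); last first.
  rewrite big_seq [RHS]big_seq; apply: eq_bigr => j jJ.
  by rewrite -/(B' j) B'J.
move=> h.
rewrite -muleA (muleC _ (mu C)) -h//.
- by congr (P _); apply/seteqP; split => t /=; tauto.
- move=> j /=; rewrite in_fset1U => /orP[/eqP ->//|]; last exact: JI.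
  by apply: sI; rewrite mem_head.
- move=> j; rewrite in_fset1U => /orP[/eqP ->//|]; last exact: Js'.
  by rewrite in_cons negb_or iis eq_sym us'.
Qed.

Lemma probability_related_to m s :
  I m -> uniq (m :: s) -> (forall i, i \in s -> I i) ->
  P (related_to m s) = \int[mu]_x mu (xsection S x) ^+ size s.
Proof.
move=> Im us sI.
have := @integral_independent_family m s fset0 (fun=> setT) (fun=> 1) Im us sI.
rewrite big_seq_fset0 /= mule1 => h.
have -> : P (related_to m s) = \int[P]_(t in related_to m s) 1.
  by rewrite integral_cst ?mul1e//; exact: measurable_related_to.
transitivity (\int[mu]_x (1 * mu (xsection S x) ^+ size s)); last first.
  by apply: eq_integral => x _; rewrite mul1e.
rewrite -h//.
- rewrite (_ : \bigcap_(i in _) _ = setT) ?setIT//.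
  by apply/seteqP; split.
Qed.

End independent_family.

(** * Existence of i.i.d. samples *)

Section iid_sample.
Local Open Scope ereal_scope.
Context d' (E : measurableType d') (R : realType) (mu : probability E R).

(** Each induction step takes the product with one more copy of [mu] and reads the
    new variable off the second component. *)
Lemma iid_sample_exists (m : nat) :
  exists (disp : measure_display) (T : measurableType disp)
    (P : probability T R) (X : nat -> {RV P >-> E}),
  (forall i A, (1 <= i <= m)%N -> measurable A -> P (X i @^-1` A) = mu A) /\
  mutually_independent [set i | (1 <= i <= m)%N] X.
Proof.
elim: m => [|m [disp [T [P [X [lawX indep]]]]]].
  pose X0 : {RV mu >-> E} :=
    HB.pack (@id E) (isMeasurableFun.Build _ _ _ _ _ (@measurable_id _ E setT)).
  exists d', E, mu, (fun=> X0); split; first by case.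
  move=> J B J0 mB.
  have -> : J = fset0.
    by apply/fsetP => i; rewrite inE; apply/negP => /J0 /=; case: i.
  rewrite big_seq_fset0 (_ : \bigcap_(i in _) _ = setT) ?probability_setT//.
  by apply/seteqP; split.
pose PP : probability (T * E)%type R := (P \x mu).
pose f (i : nat) (z : T * E) := if i == m.+1 then z.2 else X i z.1.
have mf i : measurable_fun setT (f i).
  rewrite /f; case: eqP => _; first exact: measurable_snd.
  exact: measurableT_comp.
pose Y i : {RV PP >-> E} := HB.pack (f i) (isMeasurableFun.Build _ _ _ _ _ (mf i)).
have Ym B : Y m.+1 @^-1` B = setT `*` B.
  by apply/seteqP; split => z /=; rewrite /f eqxx// => -[].
have Yi i B : i != m.+1 -> Y i @^-1` B = (X i @^-1` B) `*` setT.
  by move=> /negbTE im; apply/seteqP; split => z /=; rewrite /f im// => -[].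
have lawY i A : (1 <= i <= m.+1)%N -> measurable A -> PP (Y i @^-1` A) = mu A.
  move=> im mA; case: (eqVneq i m.+1) => [->|im1].
    by rewrite Ym /PP/= product_measure1E// [X in X * _]probability_setT mul1e.
  rewrite Yi// /PP/= product_measure1E//; last exact: measurable_funPTI.
  rewrite [X in _ * X]probability_setT mule1; apply: lawX => //.
  by move: im; rewrite [(_ <= m.+1)%N]leq_eqVlt (negbTE im1).
exists _, _, PP, Y; split => // J B JI mB.
have JY : \prod_(i <- J) PP (Y i @^-1` B i) = \prod_(i <- J) mu (B i).
  by rewrite big_seq [RHS]big_seq; apply: eq_bigr => i iJ; rewrite lawY//; exact: JI.
rewrite JY.
pose J' := (J `\ m.+1)%fset.
have J'I : [set` J'] `<=` [set i | (1 <= i <= m)%N].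
  move=> i /=; rewrite in_fsetD1 => /andP[im1 /JI /=].
  by rewrite [(_ <= m.+1)%N]leq_eqVlt (negbTE im1).
have PJ' : P (\bigcap_(i in [set` J']) (X i @^-1` B i)) = \prod_(i <- J') mu (B i).
  rewrite indep// big_seq [RHS]big_seq; apply: eq_bigr => i iJ; rewrite lawX//.
  exact: J'I.
have mJ' : measurable (\bigcap_(i in [set` J']) (X i @^-1` B i)).
  by apply: bigcap_measurableType => i _; exact: measurable_funPTI.
have [mJ|mJ] := boolP (m.+1 \in J).
- rewrite (_ : \bigcap_(i in _) _ =
     (\bigcap_(i in [set` J']) (X i @^-1` B i)) `*` B m.+1).
    rewrite /PP/= product_measure1E// [X in X * _]PJ' [RHS](big_fsetD1 _ mJ)/= muleC//.
  apply/seteqP; split => z /=.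
    move=> h; split => [i /=|].
      rewrite in_fsetD1 => /andP[im iJ]; have := h i iJ.
      by rewrite /= /f (negbTE im).
    by have := h _ mJ; rewrite /= /f eqxx.
  move=> [h1 h2] i /= iJ; rewrite /f; case: eqP => [->//|/eqP im].
  by apply: h1; rewrite /= in_fsetD1 im.
- rewrite (_ : \bigcap_(i in _) _ =
     (\bigcap_(i in [set` J']) (X i @^-1` B i)) `*` setT).
    rewrite /PP/= product_measure1E// [X in X * _]PJ' [X in _ * X]probability_setT mule1.
    by rewrite /J' mem_fsetD1.
  apply/seteqP; split => z /=.
    move=> h; split => // i /=.
    rewrite in_fsetD1 => /andP[im iJ]; have := h i iJ.
    by rewrite /= /f (negbTE im).
  move=> [h1 _] i /= iJ; rewrite /f; case: eqP => [im|/eqP im].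
    by rewrite -im iJ in mJ.
  by apply: h1; rewrite /= in_fsetD1 im.
Qed.

End iid_sample.

(** * A distribution function determines its law *)

Section orthants.
Context (R : realType) (d : nat).
Implicit Types (x y : d.-tuple R) (j : 'I_d).

Lemma measurable_levec disp (T : measurableType disp) (f g : T -> d.-tuple R) :
  measurable_fun setT f -> measurable_fun setT g ->
  measurable [set t | levec (f t) (g t)].
Proof.
move=> mf mg.
rewrite (_ : mkset _ =
    \bigcap_(j in [set: 'I_d]) [set t | tnth (f t) j <= tnth (g t) j]).
  apply: fin_bigcap_measurable => [|j _]; first exact: finite_finset.
  apply: measurable_ler_fun.
  - exact: (measurableT_comp (measurable_tnth j) mf).
  - exact: (measurableT_comp (measurable_tnth j) mg).
by apply/seteqP; split => t h j; [move=> _|]; exact: h.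
Qed.

Lemma measurable_orthant x : measurable [set y | levec y x].
Proof. by apply: measurable_levec => //; exact: measurable_cst. Qed.

Lemma tuple_bounded y : exists k : nat, forall j, tnth y j <= k%:R.
Proof.
exists (\max_(j < d) (Num.truncn `|tnth y j|).+1) => j.
apply: (le_trans (ler_norm _)); apply/ltW/(lt_le_trans (truncnS_gt _)).
by rewrite ler_nat; exact: leq_bigmax.
Qed.

Definition orthants : set (set (d.-tuple R)) :=
  [set A | exists x, A = [set y | levec y x]].

(** The identity map from tuples with the sigma-algebra generated by the orthants
    to tuples with their own sigma-algebra is measurable, because each of its
    coordinates is: the half-space of the points with coordinate [j] at most [a] is
    the union over [k] of the orthants below the point with coordinate [j] equal to
    [a] and the others equal to [k]. *)
Lemma measurable_tuple_orthants :
  @measurable _ (d.-tuple R) = <<s orthants >>.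
Proof.
apply/seteqP; split; last first.
  apply: smallest_sub; first exact: sigma_algebra_measurable.
  by move=> _ [x ->]; exact: measurable_orthant.
pose T := g_sigma_algebraType orthants.
suff mid : measurable_fun [set: T] (fun t : T => t : d.-tuple R).
  by move=> A mA; have := mid measurableT A mA; rewrite setTI.
apply/measurable_fun_tnthP => j.
apply: (@measurability _ _ T R setT _ _ (RGenOInfty.measurableE R)) => _ [_ [a ->] <-].
rewrite setTI.
pose v k : d.-tuple R := [tuple if i == j then a else k%:R | i < d].
rewrite (_ : _ @^-1` _ = ~` \bigcup_k [set y | levec y (v k)]).
  apply: measurableC; apply: bigcupT_measurable => k.
  by apply: sub_sigma_algebra; exists (v k).
apply/seteqP; split => y /=; rewrite in_itv/= andbT.
  by move=> ay [k _ /(_ j)]; rewrite tnth_mktuple eqxx leNgt ay.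
move=> h; rewrite ltNge; apply/negP => ya; apply: h.
have [k yk] := tuple_bounded y; exists k => // i.
by rewrite tnth_mktuple; case: eqP => [->|].
Qed.

(** Orthants are closed under intersection, generate the sigma-algebra and cover
    the space, so two finite measures that agree on them are equal. *)
Lemma law_of_df_unique (F : d.-tuple R -> R) (mu nu : probability (d.-tuple R) R) :
  law_has_df mu F -> law_has_df nu F -> forall A, measurable A -> mu A = nu A.
Proof.
move=> muF nuF A mA.
apply: (@measure_unique _ _ _ orthants
  (fun k => [set y | levec y [tuple k%:R | i < d]])) => //.
- exact: measurable_tuple_orthants.
- move=> _ _ [x ->] [y ->].
  exists [tuple Num.min (tnth x i) (tnth y i) | i < d].
  apply/seteqP; split => z /=.
    by move=> [zx zy] i; rewrite tnth_mktuple le_min zx zy.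
  by move=> h; split => i; have := h i; rewrite tnth_mktuple le_min => /andP[].
- by move=> k; exists [tuple k%:R | i < d].
- apply/seteqP; split => // y _; have [k yk] := tuple_bounded y.
  by exists k => // i; rewrite tnth_mktuple.
- by move=> _ [x ->]; exact: etrans (muF x) (esym (nuF x)).
- by move=> k; rewrite [ltLHS](muF _) ltry.
Qed.

End orthants.

(** * The record probability as an integral *)

Section record_probability.
Local Open Scope ereal_scope.
Context (R : realType) (d : nat).
Implicit Types (mu : probability (d.-tuple R) R) (F : d.-tuple R -> R).

Let not_below : set (d.-tuple R * d.-tuple R) := [set z | ~ levec z.1 z.2].

Let measurable_not_below : measurable not_below.
Proof.
apply: measurableC; apply: measurable_levec; [exact: measurable_fst|].
exact: measurable_snd.
Qed.

Lemma measurable_nondominating (x : d.-tuple R) :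
  measurable [set y | ~ levec x y].
Proof. by apply: measurableC; apply: measurable_levec => //; exact: measurable_cst. Qed.

Let xsection_not_below x : xsection not_below x = [set y | ~ levec x y].
Proof. by apply/seteqP; split => y; rewrite /xsection /= inE. Qed.

Lemma measurable_fun_nondominating mu :
  measurable_fun setT (fun x => mu [set y | ~ levec x y]).
Proof.
have := measurable_fun_xsection mu measurable_not_below.
by under [X in _ -> measurable_fun _ X]eq_fun do rewrite -xsection_not_below.
Qed.

Lemma probability_sets_record mu F disp (T : measurableType disp)
    (P : probability T R) (X : nat -> {RV P >-> d.-tuple R}) n :
  law_has_df mu F -> (1 <= n)%N ->
  iid_with_df F [set i | (1 <= i <= n)%N] X ->
  P (sets_record X n) = \int[mu]_x mu [set y | ~ levec x y] ^+ n.-1.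
Proof.
move=> muF n1 [lawX indep].
have lawXE i A : [set i | (1 <= i <= n)%N] i -> measurable A -> P (X i @^-1` A) = mu A.
  move=> In mA.
  exact: (@law_of_df_unique _ _ F (distribution P (X i)) mu (lawX i In) muF A mA).
have iotaE i : (i \in iota 1 n.-1) = (1 <= i < n)%N.
  by rewrite mem_iota add1n prednK.
have -> : sets_record X n = related_to X not_below n (iota 1 n.-1).
  apply/seteqP; split => t h i.
    by rewrite iotaE; exact: h.
  by rewrite -iotaE; exact: h.
rewrite (probability_related_to indep lawXE)//=.
- by rewrite size_iota; apply: eq_integral => x _; rewrite xsection_not_below.
- by rewrite n1 leqnn.
- by rewrite iota_uniq andbT iotaE ltnn andbF.
- by move=> i; rewrite iotaE => /andP[-> /ltnW].
Qed.

(** Since [probability_sets_record] gives the same value for all samples with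
    distribution function [F], the set from which [record_prob] picks is a
    singleton as soon as one sample exists. *)
Lemma record_probE mu F n : law_has_df mu F -> (1 <= n)%N ->
  (record_prob n F)%:E = \int[mu]_x mu [set y | ~ levec x y] ^+ n.-1.
Proof.
move=> muF n1.
have [disp [T [P [X [lawX indep]]]]] := iid_sample_exists mu n.
have iidX : iid_with_df F [set i | (1 <= i <= n)%N] X.
  split => // i In x; rewrite -muF; apply: lawX => //; exact: measurable_orthant.
have PE := probability_sets_record muF n1 iidX.
have mrec : measurable (sets_record X n).
  rewrite (_ : sets_record X n = \bigcap_(i in [set i | (1 <= i < n)%N])
    ~` [set t | levec (X n t) (X i t)])//.
  apply: bigcap_measurableType => i _; apply: measurableC.
  exact: measurable_levec.
have Pfin : P (sets_record X n) \is a fin_num by exact: fin_num_measure.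
rewrite -PE -(fineK Pfin); congr EFin.
apply: xget_unique.
  by exists disp, T, P, X; rewrite fineK.
move=> p [disp' [T' [P' [X' [iid']]]]] Pp.
by rewrite PE -(probability_sets_record muF n1 iid') Pp.
Qed.

End record_probability.

(** * Bounds on the record probability *)

Section maximum.
Local Open Scope ereal_scope.
Context d (E : measurableType d) (R : realType) (mu : probability E R).

(** The integral is the probability that a given vector of an [n]-sample
    maximizes [g]. It does not depend on the chosen vector, and in every outcome
    some vector maximizes [g], so [n] times the integral is at least 1. *)
Lemma integral_expe_ge_invn (g : E -> R) n : measurable_fun setT g -> (1 <= n)%N ->
  (n%:R^-1)%:E <= \int[mu]_x mu [set y | (g y <= g x)%R] ^+ n.-1.
Proof.
move=> mg n1.
have [disp [T [P [X [lawX indep]]]]] := iid_sample_exists mu n.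
pose S : set (E * E) := [set z | (g z.2 <= g z.1)%R].
have mS : measurable S.
  apply: measurable_ler_fun; apply: measurableT_comp => //.
pose s i := rem i (iota 1 n).
have sE i j : (j \in s i) = (j != i) && (1 <= j <= n)%N.
  by rewrite mem_rem_uniq ?iota_uniq// inE/= mem_iota add1n ltnS.
set J := \int[mu]_x _.
have PJ i : (1 <= i <= n)%N -> P (related_to X S i (s i)) = J.
  move=> In.
  rewrite (probability_related_to indep lawX mS)//=.
  - rewrite size_rem ?mem_iota ?add1n ?ltnS// size_iota.
    apply: eq_integral => x _; congr (mu _ ^+ _).
    by apply/seteqP; split => y; rewrite /xsection /= inE.
  - by rewrite rem_uniq ?iota_uniq// andbT sE eqxx.
  - by move=> j; rewrite sE => /andP[].
have cover : [set: T] `<=` \bigcup_(i in `I_n) related_to X S i.+1 (s i.+1).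
  move=> t _; pose i0 := Ordinal n1.
  pose m := [arg max_(i > i0) g (X (nat_of_ord i).+1 t)]%O.
  exists (nat_of_ord m) => //= j; rewrite sE => /and3P[_ j1 jn].
  have jn' : (j.-1 < n)%N by rewrite prednK.
  rewrite /S/= /m; case: arg_maxP => // i _ /(_ (Ordinal jn') isT) /=.
  by rewrite prednK.
have : 1 <= \sum_(i < n) J.
  rewrite -(probability_setT P).
  apply: (le_trans (@content_subadditive _ _ _ P setT
     (fun i => related_to X S i.+1 (s i.+1)) n _ _ _)).
  - by move=> i _; exact: measurable_related_to.
  - exact: measurableT.
  - by rewrite -(bigcup_mkord n (fun i => related_to X S i.+1 (s i.+1))).
  - by apply: lee_sum => i _; rewrite [leLHS]PJ//=.
have Jfin : J \is a fin_num.
  rewrite -(PJ n) ?n1 ?leqnn//; apply: fin_num_measure.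
  exact: measurable_related_to.
rewrite -(fineK Jfin) sumEFin sumr_const card_ord lee_fin => J1.
by rewrite lee_fin -div1r ler_pdivrMr ?ltr0n// mulr_natr.
Qed.

End maximum.

Section continuity.
Context (R : realType) (d : nat).
Implicit Types F : d.-tuple R -> R.

Lemma continuous_tupleP F :
  continuous (fun v : 'rV[R]_d => F [tuple v ord0 j | j < d]) <->
  forall x (e : R), 0 < e -> exists2 r : R, 0 < r &
    forall y, (forall j, `|tnth x j - tnth y j| < r) -> `|F x - F y| < e.
Proof.
have tupE (x : d.-tuple R) :
    [tuple (\row_(i < d) tnth x i) ord0 j | j < d] = x.
  by apply: eq_from_tnth => j; rewrite tnth_mktuple mxE.
split=> [cF x e e0|cF v].
  have /cvgrPdist_lt/(_ e e0) := cF (\row_(i < d) tnth x i).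
  rewrite tupE => /nbhs_ballP[r /= r0 h]; exists r => // y xy.
  have := h (\row_(i < d) tnth y i); rewrite /= tupE; apply.
  by split => // i j; rewrite !mxE; exact: xy.
apply/(cvgrPdist_lt (FF := nbhs_filter v)) => e e0.
have [r r0 h] := cF [tuple v ord0 j | j < d] e e0.
apply/nbhs_ballP; exists r => //= w [_ vw]; apply: h => j.
by rewrite !tnth_mktuple; exact: vw.
Qed.

(** Cut the hyperplane by the orthants with vertex [v a k], where coordinate [j] is
    [a] and the others are [k]. For each [b < a] such a piece is disjoint from the
    orthant with vertex [v b k], so its mass is at most [F (v a k) - F (v b k)],
    which tends to 0 as [b] tends to [a]. *)
Lemma hyperplane_null F (mu : probability (d.-tuple R) R) j a :
  law_has_df mu F -> continuous (fun v : 'rV[R]_d => F [tuple v ord0 j | j < d]) ->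
  mu [set y | tnth y j = a] = 0%E.
Proof.
move=> muF /continuous_tupleP cF.
have mtj : measurable_fun setT (fun y : d.-tuple R => tnth y j).
  exact: measurable_tnth.
have mha : measurable [set y : d.-tuple R | tnth y j = a].
  by have := mtj measurableT [set a] (measurable_set1 a); rewrite setTI.
pose v (b : R) k : d.-tuple R := [tuple if i == j then b else k%:R | i < d].
pose N (k : nat) := [set y | tnth y j = a] `&` [set y | levec y (v a k)].
have mN k : measurable (N k) by apply: measurableI => //; exact: measurable_orthant.
suff N0 k : mu (N k) = 0%E.
  apply: measure_negligible => //.
  apply: (@negligibleS _ _ _ _ (\bigcup_k N k)).
    move=> y /= ya; have [k yk] := tuple_bounded y; exists k => //; split => // i.
    by rewrite tnth_mktuple; case: eqP => [->|_]; rewrite ?ya.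
  apply: negligible_bigcup => k; by apply/negligibleP; [exact: mN|exact: N0].
apply/eqP; rewrite -measure_le0; apply/lee_addgt0Pr => e e0; rewrite add0e.
have [r r0 h] := cF (v a k) e e0.
have r20 : 0 < r / 2 by rewrite divr_gt0.
pose b := a - r / 2.
have ba : b <= a by rewrite gerBl ltW.
have sub : N k `<=` [set y | levec y (v a k)] `\` [set y | levec y (v b k)].
  move=> y [/= ya yv]; split => // /(_ j).
  by rewrite tnth_mktuple eqxx ya /b leNgt ltrBlDr ltrDl r20.
apply: (le_trans (le_measure _ _ _ sub)).
- by rewrite inE.
- by rewrite inE; apply: measurableD; exact: measurable_orthant.
have inj : [set y | levec y (v b k)] `<=` [set y | levec y (v a k)].
  move=> y h1 i; have := h1 i; rewrite !tnth_mktuple; case: eqP => // _ yb.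
  exact: le_trans ba.
rewrite measureD; last 3 first.
- exact: measurable_orthant.
- exact: measurable_orthant.
- by rewrite [ltLHS]muF ltry.
rewrite (setIidr inj) [X in (X - _)%E]muF [X in (_ - X)%E]muF -EFinB lee_fin.
apply: (le_trans (ler_norm _)); apply/ltW/h => i; rewrite !tnth_mktuple.
case: eqP => _; last by rewrite subrr normr0.
rewrite /b opprB addrCA subrr addr0 gtr0_norm//.
by rewrite ltr_pdivrMr// ltr_pMr// ltr1n.
Qed.

(** A point strictly below [x] in coordinate [j] does not dominate [x], and up to
    a null hyperplane strict and weak inequalities have the same mass. *)
Lemma record_prob_ge F n (j : 'I_d) : continuous_df F -> (1 <= n)%N ->
  n%:R^-1 <= record_prob n F.
Proof.
move=> [[mu muF] cF] n1; rewrite -lee_fin (record_probE muF n1).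
apply: (le_trans (@integral_expe_ge_invn _ _ _ mu _ n (measurable_tnth j) n1)).
apply: ge0_le_integral => //.
- by move=> x _; exact: expe_ge0.
- apply: measurable_fun_expe.
  have mS : measurable [set z : d.-tuple R * d.-tuple R | tnth z.2 j <= tnth z.1 j].
    by apply: measurable_ler_fun;
       [exact: (measurableT_comp (measurable_tnth j) measurable_snd)
       |exact: (measurableT_comp (measurable_tnth j) measurable_fst)].
  have := measurable_fun_xsection mu mS.
  apply: eq_measurable_fun => x _ /=; congr (mu _).
  by apply/seteqP; split => y; rewrite /xsection /= inE.
- by apply: measurable_fun_expe; exact: measurable_fun_nondominating.
- move=> x _; apply: lee_expe => //.
  have mle : measurable [set y : d.-tuple R | tnth y j <= tnth x j].
    by apply: measurable_ler_fun => //; exact: measurable_tnth.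
  have meq : measurable [set y : d.-tuple R | tnth y j = tnth x j].
    have := @measurable_tnth _ R d j measurableT _ (measurable_set1 (tnth x j)).
    by rewrite setTI.
  apply: (@le_trans _ _ (mu ([set y | ~ levec x y] `|` [set y | tnth y j = tnth x j]))).
    apply: le_measure; rewrite ?inE//.
      by apply: measurableU => //; exact: measurable_nondominating.
    move=> y /=; rewrite le_eqVlt => /orP[/eqP|yx]; [by right|left].
    by move=> /(_ j); rewrite leNgt yx.
  apply: (le_trans (measureU2 _ _ _)) => //; first exact: measurable_nondominating.
  by rewrite [X in (_ + X)%E](hyperplane_null j _ muF cF) adde0.
Qed.

Lemma record_prob_le1 F n : continuous_df F -> (1 <= n)%N -> record_prob n F <= 1.
Proof.
move=> [[mu muF] cF] n1; rewrite -lee_fin (record_probE muF n1).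
apply: (@le_trans _ _ (\int[mu]_x 1)%E); last first.
  by rewrite integral_cst// mul1e; exact: probability_le1.
apply: ge0_le_integral => //.
- by move=> x _; exact: expe_ge0.
- by apply: measurable_fun_expe; exact: measurable_fun_nondominating.
- move=> x _; rewrite -[leRHS](_ : 1 ^+ n.-1 = 1)%E; last first.
    by rewrite -EFin_expe expr1n.
  apply: lee_expe => //.
  apply: probability_le1; exact: measurable_nondominating.
Qed.

End continuity.

(** * Folded diagonals: attaining every value *)

(** If the vertices [x] and [y] are within [r] in every coordinate, the orthants
    below them differ only inside the [d] slabs of half-width [r] around the
    coordinates of [x]. *)
Lemma continuous_df_of_slabs (R : realType) (d : nat)
    (mu : probability (d.-tuple R) R) (C : R) :
  (forall j a r, 0 < r ->
    (mu [set z | `|tnth z j - a| <= r]%R <= (C * r)%:E)%E) ->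
  continuous_df (fun x => fine (mu [set y | levec y x])).
Proof.
move=> slab.
have mO (x : d.-tuple R) : measurable [set y | levec y x].
  exact: measurable_orthant.
have muE x : mu [set y | levec y x] = (fine (mu [set y | levec y x]))%:E.
  by rewrite fineK// fin_num_measure.
split; first by exists mu => x; rewrite -muE.
apply: (@continuous_tupleP R d (fun x => fine (mu [set y | levec y x]))).2 => x e e0.
have C0 : 0 <= `|C| *+ d by rewrite mulrn_wge0.
pose r := e / (`|C| *+ d + 1).
have D0 : 0 < `|C| *+ d + 1 by rewrite ltr_wpDl.
have r0 : 0 < r by rewrite divr_gt0.
have mslab j (a : R) : measurable [set z : d.-tuple R | `|tnth z j - a| <= r].
  apply: measurable_ler_fun => //.
  apply: measurableT_comp => //; apply: measurable_funB => //.
  exact: measurable_tnth.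
exists r => // y xy.
pose slabs : set (d.-tuple R) :=
  \big[setU/set0]_(j < d) [set z : d.-tuple R | `|tnth z j - tnth x j| <= r].
have mslabs : measurable slabs by apply: bigsetU_measurable.
have slabsE : (mu slabs <= (`|C| * r *+ d)%:E)%E.
  apply: (@le_trans _ _ (\sum_(j < d)
      mu [set z : d.-tuple R | `|tnth z j - tnth x j| <= r]%R)%E).
    suff [] : measurable slabs /\ (mu slabs <= \sum_(j < d)
      mu [set z : d.-tuple R | `|tnth z j - tnth x j| <= r]%R)%E by [].
    apply: (big_ind2 (fun A s => measurable A /\ (mu A <= s)%E)).
    - by rewrite measure0.
    - move=> A a B b [mA Aa] [mB Bb]; split; first exact: measurableU.
      by apply: (le_trans (measureU2 _ _ _)) => //; rewrite leeD.
    - by [].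
  apply: (@le_trans _ _ (\sum_(j < d) (`|C| * r)%:E)%E).
    apply: lee_sum => j _; apply: (le_trans (slab _ _ _ r0)).
    by rewrite lee_fin; apply: ler_wpM2r; [exact: ltW|exact: ler_norm].
  by rewrite sumEFin sumr_const card_ord.
have inslabs z j : `|tnth z j - tnth x j| <= r -> slabs z.
  move=> h; rewrite /slabs -bigcup_seq; exists j => //=.
  by rewrite mem_index_enum.
have sub1 : [set z | levec z x] `<=` [set z | levec z y] `|` slabs.
  move=> z /= zx; have [zy|/existsNP[j /negP]] := pselect (levec z y); first by left.
  rewrite -ltNge => yz; right; apply: (inslabs z j).
  have := xy j; rewrite !ltr_norml !ler_norml => /andP[h1 h2].
  have := zx j => h3; apply/andP; split; lra.
have sub2 : [set z | levec z y] `<=` [set z | levec z x] `|` slabs.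
  move=> z /= zy; have [zx|/existsNP[j /negP]] := pselect (levec z x); first by left.
  rewrite -ltNge => xz; right; apply: (inslabs z j).
  have := xy j; rewrite !ltr_norml !ler_norml => /andP[h1 h2].
  have := zy j => h3; apply/andP; split; lra.
have bound u v : [set z | levec z u] `<=` [set z | levec z v] `|` slabs ->
    fine (mu [set z | levec z u]) <= fine (mu [set z | levec z v]) + `|C| * r *+ d.
  move=> uv; rewrite -lee_fin EFinD -!muE.
  apply: (@le_trans _ _ (mu ([set z | levec z v] `|` slabs))).
    by apply: le_measure; rewrite ?inE//; exact: measurableU.
  by apply: (le_trans (measureU2 _ _ _)) => //; rewrite leeD.
have Cr : `|C| * r *+ d < e.
  rewrite -mulrnAl /r mulrCA gtr_pMr// ltr_pdivrMr// mul1r ltrDl//.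
rewrite ltr_norml; have := bound _ _ sub1; have := bound _ _ sub2 => h1 h2.
by apply/andP; split; lra.
Qed.

Section power_integral.
Context (R : realType).
Local Notation mu := (@lebesgue_measure R).

Lemma integral_exprn (t : R) k : 0 <= t <= 1 ->
  (\int[mu]_(x in `[t, 1%R]) (x ^+ k)%:E = ((1 - t ^+ k.+1) / k.+1%:R)%:E)%E.
Proof.
move=> /andP[t0]; rewrite le_eqVlt => /predU1P[->|t1].
  by rewrite set_itv1 integral_set1 expr1n subrr mul0r.
rewrite (@continuous_FTC2 _ _ (fun x => x ^+ k.+1 / k.+1%:R))//=.
- by rewrite expr1n mulrBl EFinB.
- by apply: continuous_subspaceT => x; exact: exprn_continuous.
- split.
  + by move=> y _; apply: derivableM => //; exact: exprn_derivable.
  + apply: cvg_at_right_filter; apply: cvgMl => //; exact: exprn_continuous.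
  + apply: cvg_at_left_filter; apply: cvgMl => //; exact: exprn_continuous.
- move=> x _; rewrite derive1Mr; last exact: exprn_derivable.
  rewrite exp_derive1 /= -[_ *: _]/(_ * _) mulrC mulrA mulVf ?mul1r//.
Qed.

Local Notation U := (uniform_prob (@ltr01 R)).

Lemma uniform01E A : measurable A -> U A = mu (A `&` `[0%R, 1%R]).
Proof.
move=> mA; have mA1 : measurable_fun setT (fun x => (\1_A x)%:E : \bar R).
  exact/measurable_EFinP/measurable_indic.
have A0 x : (0 <= (\1_A x)%:E :> \bar R)%E by rewrite lee_fin.
have := integral_uniform (@ltr01 R) mA1 A0.
rewrite integral_indic// setIT => ->.
by rewrite subr0 invr1 mul1e integral_indic.
Qed.

Lemma uniform01_le (a b : R) : a <= b -> (U `[a, b] <= (b - a)%:E)%E.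
Proof.
move=> ab; rewrite uniform01E//.
apply: (@le_trans _ _ (mu `[a, b])); first by rewrite measureIl.
rewrite lebesgue_measure_itv/=; case: ifP => // _.
by rewrite lee_fin subr_ge0.
Qed.

End power_integral.

Section folded_diagonal.
Context (R : realType) (d : nat) (i0 i1 : 'I_d).
Hypothesis i01 : i0 != i1.
Variable t : R.
Hypotheses (t0 : 0 <= t) (t1 : t <= 1).

(** For [u] in [[0, 1]] the value [3 - u] lies in [[2, 3]], above all the
    coordinates that are not folded: hence a folded point is never dominated by an
    unfolded one. *)
Definition fold_coord (u : R) : R := if u < t then 3 - u else u.

Definition folded_diagonal (u : R) : d.-tuple R :=
  [tuple if j == i1 then fold_coord u else u | j < d].

Lemma measurable_fold_coord : measurable_fun setT fold_coord.
Proof.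
apply: measurable_fun_ifT => //; first exact: measurable_fun_ltr.
by apply: measurable_funB.
Qed.

Lemma measurable_folded_diagonal : measurable_fun setT folded_diagonal.
Proof.
apply/measurable_fun_tnthP => j.
rewrite (_ : _ \o _ = if j == i1 then fold_coord else id).
  by case: ifP => _; [exact: measurable_fold_coord|exact: measurable_id].
by apply/funext => u /=; rewrite tnth_mktuple; case: ifP.
Qed.

Local Notation U := (uniform_prob (@ltr01 R)).

Definition folded_rv : {RV U >-> d.-tuple R} :=
  HB.pack (folded_diagonal : measurableTypeR R -> d.-tuple R)
    (isMeasurableFun.Build _ _ (measurableTypeR R) _ _ measurable_folded_diagonal).

Definition folded_law : probability (d.-tuple R) R := distribution U folded_rv.

(** The slab pulls back into two intervals of length [2 * r], one for each branch
    of [fold_coord]. *)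
Lemma folded_law_slab j (a r : R) : 0 < r ->
  (folded_law [set z | `|tnth z j - a| <= r]%R <= (4 * r)%:E)%E.
Proof.
move=> r0; rewrite /folded_law /= /distribution /pushforward /=.
apply: (@le_trans _ _ (U (`[a - r, a + r] `|` `[3 - a - r, 3 - a + r]))).
  apply: le_measure; rewrite ?inE.
  - have := measurable_funPTI folded_rv (Y := [set z | `|tnth z j - a| <= r]).
    apply; apply: measurable_ler_fun => //.
    apply: measurableT_comp => //; apply: measurable_funB => //.
    exact: measurable_tnth.
  - exact: measurableU.
  - move=> u /=; rewrite tnth_mktuple /fold_coord !in_itv/= ler_norml.
    case: ifP => _; last by move=> /andP[? ?]; left; apply/andP; split; lra.
    case: ifP => _ /andP[? ?]; last by left; apply/andP; split; lra.
    by right; apply/andP; split; lra.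
apply: (le_trans (measureU2 _ _ _)) => //.
have -> : (4 * r)%:E = (((a + r) - (a - r))%:E + ((3 - a + r) - (3 - a - r))%:E)%E.
  by rewrite -EFinD; congr EFin; ring.
by apply: leeD; apply: uniform01_le; lra.
Qed.

Definition folded_df (x : d.-tuple R) : R := fine (folded_law [set y | levec y x]).

Lemma continuous_folded_df : continuous_df folded_df.
Proof. by apply: (@continuous_df_of_slabs _ _ _ 4) => j a r; exact: folded_law_slab. Qed.

Lemma law_has_df_folded : law_has_df folded_law folded_df.
Proof. by move=> x; rewrite fineK// fin_num_measure//; exact: measurable_orthant. Qed.

(** For two folded points, coordinate [i0] gives [u <= v] and coordinate [i1] gives
    [v <= u]: this is where two distinct coordinates are used. *)
Lemma levec_folded (u v : R) : 0 <= u <= 1 -> 0 <= v <= 1 ->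
  levec (folded_diagonal u) (folded_diagonal v) <->
  if u < t then v = u else u <= v.
Proof.
move=> /andP[u0 u1] /andP[v0 v1]; split.
  move=> uv; have := uv i0; have := uv i1.
  rewrite !tnth_mktuple eqxx (negbTE i01) /fold_coord.
  clear uv; case: (ltP u t) => ut; case: (ltP v t) => vt; lra.
case: (ltP u t) => ut; first by move=> -> j; rewrite lexx.
move=> uv j; rewrite !tnth_mktuple /fold_coord ltNge ut /=.
by case: ifP => // _; case: (ltP v t) => vt; lra.
Qed.

Lemma folded_law_nondominating (u : R) : 0 <= u <= 1 ->
  folded_law [set y | ~ levec (folded_diagonal u) y] =
  (if u < t then 1 else u)%:E.
Proof.
move=> u01.
have mD : measurable [set y | levec (folded_diagonal u) y].
  by apply: measurable_levec => //; exact: measurable_cst.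
rewrite (_ : [set y | _] = ~` [set y | levec (folded_diagonal u) y])//.
rewrite probability_setC// /folded_law /= /distribution /pushforward /=.
rewrite uniform01E; last by have := measurable_funPTI folded_rv mD.
rewrite (_ : _ `&` _ = if u < t then [set u] else `[u, 1]%classic).
  case: ifP => ut; first by rewrite lebesgue_measure_set1 sube0.
  rewrite lebesgue_measure_itv/= lte_fin; case: ifP => u1.
    by rewrite -!EFinB opprB addrC subrK.
  rewrite sube0; congr EFin; case/andP: u01 => _ u1'.
  by apply/eqP; rewrite eq_le u1' leNgt u1.
apply/seteqP; split => v /=.
  rewrite in_itv/= => -[uv v01]; move: uv => /(levec_folded u01 v01).
  by case: ifP => //= _ uv; rewrite in_itv/= uv; case/andP: v01.
move=> h.
have v01 : 0 <= v <= 1.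
  move: h u01; case: ifP => _ /=; first by move=> ->.
  rewrite in_itv/= => /andP[h ->] /andP[u0 _]; rewrite andbT.
  exact: le_trans h.
split; last by rewrite in_itv.
apply/(levec_folded u01 v01); move: h.
by case: ifP => //= _; rewrite in_itv/= => /andP[].
Qed.

Lemma record_prob_folded n : (1 <= n)%N ->
  record_prob n folded_df = t + (1 - t ^+ n) / n%:R.
Proof.
move=> n1; apply: EFin_inj; rewrite (record_probE law_has_df_folded n1).
have mphi := measurable_fun_expe n.-1 (measurable_fun_nondominating folded_law).
rewrite /folded_law ge0_integral_distribution//; last first.
  by move=> x; exact: expe_ge0.
rewrite integral_uniform//; last 2 first.
- exact: measurableT_comp.
- by move=> x; exact: expe_ge0.
rewrite subr0 invr1 mul1e.
transitivity (\int[lebesgue_measure]_(u in `[0%R, 1%R])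
    ((if u < t then 1 else u) ^+ n.-1)%:E)%E.
  apply: eq_integral => u; rewrite inE/= in_itv/= => u01.
  by rewrite EFin_expe -folded_law_nondominating.
have -> : `[0, 1]%classic = `[0, t[ `|` `[t, 1] :> set R.
  by rewrite -itv_bndbnd_setU// bnd_simp.
rewrite ge0_integral_setU//=; last 3 first.
- apply/measurable_EFinP/measurable_funTS/measurable_funX.
  by apply: measurable_fun_ifT => //; exact: measurable_fun_ltr.
- move=> u _; rewrite lee_fin exprn_ge0//; case: ifP => // /negbT.
  by rewrite -leNgt; exact: le_trans.
- apply/disj_setPS => u /=; rewrite !in_itv/= => -[/andP[_ ut] /andP[tu _]].
  by move: ut; rewrite ltNge tu.
rewrite EFinD; congr (_ + _)%E.
  transitivity (\int[lebesgue_measure]_(u in `[0%R, t[) 1)%E.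
    apply: eq_integral => u; rewrite inE/= in_itv/= => /andP[_ ->].
    by rewrite expr1n.
  rewrite integral_cst// mul1e [LHS]lebesgue_measure_itv/= lte_fin.
  case: ifP => [_|/negbT]; first by rewrite sube0.
  by rewrite -leNgt => t0'; congr EFin; apply/eqP; rewrite eq_le t0 t0'.
transitivity (\int[lebesgue_measure]_(u in `[t, 1%R]) (u ^+ n.-1)%:E)%E.
  apply: eq_integral => u; rewrite inE/= in_itv/= => /andP[tu _].
  by rewrite ltNge tu.
by rewrite integral_exprn ?t0// prednK.
Qed.

End folded_diagonal.

Lemma interpolation_onto (R : realType) n (p : R) : (1 <= n)%N ->
  n%:R^-1 <= p <= 1 -> exists2 t : R, 0 <= t <= 1 & t + (1 - t ^+ n) / n%:R = p.
Proof.
move=> n1 /andP[p0 p1].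
pose f (t : R) := t + (1 - t ^+ n) / n%:R.
have cf : continuous f.
  move=> t; apply: cvgD; first exact: cvg_id.
  apply: cvgMl; apply: cvgB; first exact: cvg_cst.
  exact: exprn_continuous.
have f0 : f 0 = n%:R^-1 by rewrite /f add0r expr0n gtn_eqF// subr0 mul1r.
have f1 : f 1 = 1 by rewrite /f expr1n subrr mul0r addr0.
have [|t] := @IVT _ f 0 1 p ler01 (continuous_subspaceT cf).
  by rewrite f0 f1 ge_min le_max p0 p1 orbT.
by rewrite in_itv/= => t01 ft; exists t.
Qed.

Theorem corollary1p14 (R : realType) (d n : nat) (hd : (2 <= d)%N) (hn : (1 <= n)%N) :
  [set record_prob n F | F in [set F : d.-tuple R -> R | continuous_df F]]
  = [set p : R | n%:R^-1 <= p <= 1].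
Proof.
pose i0 : 'I_d := Ordinal (ltnW hd); pose i1 : 'I_d := Ordinal hd.
have i01 : i0 != i1 by [].
apply/seteqP; split => [_ [F cF <-]|p /= np1].
  by rewrite /= (record_prob_ge i0)// record_prob_le1.
have [t /andP[t0 t1] <-] := interpolation_onto hn np1.
exists (folded_df i1 t); first exact: continuous_folded_df.
exact: (record_prob_folded i01).
Qed.
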